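(* Let $S$ be an unambiguous semigroup and fix a choice of representatives $r_s,\ell_s$ as in the context. The rewrite system consisting of the rules (1.1)–(1.6), (2.1)–(2.4) of the context defines $(S)_{\mathrm{reg}}$; that is, the congruence on the free semigroup over $S\cup\overline{S-\{0\}}\cup\{0\}$ generated by all pairs (left side, right side) of these rules is equal to the congruence generated by the defining relations of $(S)_{\mathrm{reg}}$.
   Context: Let $S$ be a semigroup. $0$ is the zero of $S$ if $S$ has one; otherwise $0$ is a new symbol not in $S$ (and then $S-\{0\}=S$). $S^1$ is $S$ if $S$ is a monoid, and otherwise $S$ with a new identity adjoined. $\leq_{\mathcal L},<_{\mathcal L},\equiv_{\mathcal L}$, $\leq_{\mathcal R},<_{\mathcal R},\equiv_{\mathcal R}$ are Green's preorders, their strict parts and equivalences ($s\leq_{\mathcal L}t$ iff $s\in S^1t$; $s\leq_{\mathcal R}t$ iff $s\in tS^1$), and $\mathcal D,\mathcal H$ are Green's usual relations. ''$\mathcal L$-incomparable'' means neither $s\leq_{\mathcal L}t$ nor $t\leq_{\mathcal L}s$; ''$\mathcal L$-comparable'' is the negation; similarly for $\mathcal R$. $S$ is unambiguous iff for all $s,t,u\in S-\{0\}$: $s>_{\mathcal L}u<_{\mathcal L}t$ implies that $s,t$ are $\mathcal L$-comparable, and $s>_{\mathcal R}u<_{\mathcal R}t$ implies that $s,t$ are $\mathcal R$-comparable. $\overline{S-\{0\}}=\{\overline s:s\in S-\{0\}\}$ is a copy of $S-\{0\}$ disjoint from $S\cup\{0\}$, with $\overline{\overline s}=s$ and the convention $\overline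 0=0$. Strings are written as tuples; $st$ denotes the product in $S$ and $(s,t)$ the string of length 2. $(S)_{\mathrm{reg}}$ is the semigroup presented by generators $S\cup\overline{S-\{0\}}\cup\{0\}$ and relations: $(s,t)=(st)$ for $s,t\in S$; $(\overline s,\overline t)=(\overline{ts})$ for $s,t\in S-\{0\}$; $(0)=(0,0)=(0,s)=(s,0)=(0,\overline s)=(\overline s,0)$ for $s\in S$; $(s,\overline t)=(0)$ if $s,t\in S-\{0\}$ are $\mathcal L$-incomparable; $(\overline s,t)=(0)$ if $s,t\in S-\{0\}$ are $\mathcal R$-incomparable; $(s,\overline s,s)=(s)$ and $(\overline s,s,\overline s)=(\overline s)$ for $s\in S-\{0\}$. Representatives: choose one element in every $\mathcal R$-class and one in every $\mathcal L$-class of $S$, so that $\mathcal D$-related representatives of $\mathcal R$-classes are $\mathcal L$-related, $\mathcal D$-related representatives of $\mathcal L$-classes are $\mathcal R$-related, and a representative of an $\mathcal L$-class and a representative of an $\mathcal R$-class lying in the same $\mathcal H$-class are equal. $r_s$ (resp. $\ell_s$) is the chosen representative of the $\mathcal R$-class (resp. $\mathcal L$-class) of $s$. Partial functions (arguments in $S-\{0\}$; values do not depend on the choices): - if $u\leq_{\mathcal L}v\geq_{\mathcal R}w$, then $B(u,v,w)=uz$ where $z\in S^1$ satisfies $w=vz$; - if $u\geq_{\mathcal L}v$, then $B_{\mathcal R}(u,v)=x r_u$ where $x\in S^1$ satisfies $v=xu$; - if $v\leq_{\mathcal R}u$, then $B_{\mathcal L}(v,u)=\ell_u y$ where $y\in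 S^1$ satisfies $v=uy$. Rewrite rules: (1.1) $(s,t)\to(st)$ and $(\overline s,\overline t)\to(\overline{ts})$, for $s,t\in S$; (1.2) $(0,0)\to(0)$, $(0,s)\to(0)$, $(s,0)\to(0)$, $(0,\overline s)\to(0)$, $(\overline s,0)\to(0)$, for $s\in S$; (1.3) $(s,\overline t)\to(0)$ if $s,t\in S-\{0\}$ are $\mathcal L$-incomparable; (1.4) $(\overline s,t)\to(0)$ if $s,t\in S-\{0\}$ are $\mathcal R$-incomparable; (1.5) $(u,\overline v,w)\to(B(u,v,w))$ if $u,v,w\in S-\{0\}$ and $u\leq_{\mathcal L}v\geq_{\mathcal R}w$; (1.6) $(\overline u,v,\overline w)\to(\overline{B(w,v,u)})$ if $u,v,w\in S-\{0\}$ and $u\leq_{\mathcal R}v\geq_{\mathcal L}w$; and, for $s,t\in S-\{0\}$: (2.1) $(s,\overline t)\to(r_s,\overline{B_{\mathcal R}(s,t)})$ if $s>_{\mathcal L}t$ and $s\neq r_s$; (2.2) $(\overline s,t)\to(\overline{\ell_s},B_{\mathcal L}(t,s))$ if $s>_{\mathcal R}t$ and $s\neq\ell_s$; (2.3) $(\overline t,s)\to(\overline{B_{\mathcal L}(t,s)},\ell_s)$ if $t\leq_{\mathcal R}s$ and $s\neq\ell_s$; (2.4) $(t,\overline s)\to(B_{\mathcal R}(s,t),\overline{r_s})$ if $t\leq_{\mathcal L}s$ and $s\neq r_s$. *)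

(* Defs.v *)
From HB Require Import structures.
From mathcomp Require Import all_boot.
From mathcomp Require Import boolp.

Set Implicit Arguments.
Unset Strict Implicit.
Unset Printing Implicit Defensive.

Local Open Scope group_scope.

Section GeneratedCongruence.
Variables (T : semigroupType) (R : T -> T -> Prop).

Inductive gen_congr : T -> T -> Prop :=
| congr_base x y : R x y -> gen_congr x y
| congr_refl x : gen_congr x x
| congr_sym x y : gen_congr x y -> gen_congr y x
| congr_trans x y z : gen_congr x y -> gen_congr y z -> gen_congr x z
| congr_mul x x' y y' :
    gen_congr x x' -> gen_congr y y' -> gen_congr (x * y) (x' * y').

End GeneratedCongruence.

(* The free semigroup over A: non-empty words under concatenation. *)
Section FreeSemigroup.
Variable A : choiceType.

Definition free_semigroup : Type := {w : seq A | w != [::]}.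

HB.instance Definition _ := Choice.on free_semigroup.

Definition str (a : A) (w : seq A) : free_semigroup :=
  exist (fun w : seq A => w != [::]) (a :: w) isT.

Fact fs_mul_subproof (v w : free_semigroup) : val v ++ val w != [::].
Proof. by case: v w => [[|a v] //= _] w. Qed.

Definition fs_mul (v w : free_semigroup) : free_semigroup :=
  exist (fun w : seq A => w != [::]) (val v ++ val w) (fs_mul_subproof v w).

Fact fs_mulA : associative fs_mul.
Proof. by move=> u v w; apply: val_inj; rewrite /= catA. Qed.

HB.instance Definition _ := isSemigroup.Build free_semigroup fs_mulA.

End FreeSemigroup.

Notation "[str x ]" := (str x nil) (at level 0, format "[str  x ]").
Notation "[str x ; y ; .. ; z ]" := (str x (cons y .. (cons z nil) ..))
  (at level 0, format "[str  x ;  y ;  .. ;  z ]").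

Section Green.
Variable S : semigroupType.
Implicit Types s t u v w : S.

Definition is_monoid : Prop := exists e : S, forall s, e * s = s /\ s * e = s.

(* S^1 sits in option S; None stands for the adjoined identity, which is
   present exactly when S is not already a monoid. *)
Definition in_S1 (z : option S) : Prop :=
  if z is Some _ then True else ~ is_monoid.

Definition lmul1 (z : option S) (t : S) : S := if z is Some x then x * t else t.
Definition rmul1 (t : S) (z : option S) : S := if z is Some x then t * x else t.

Definition leL s t : Prop := exists2 z, in_S1 z & s = lmul1 z t.
Definition leR s t : Prop := exists2 z, in_S1 z & s = rmul1 t z.
Definition ltL s t : Prop := leL s t /\ ~ leL t s.
Definition ltR s t : Prop := leR s t /\ ~ leR t s.
Definition eqvL s t : Prop := leL s t /\ leL t s.
Definition eqvR s t : Prop := leR s t /\ leR t s.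
Definition eqvD s t : Prop := exists2 u, eqvL s u & eqvR u t.
Definition eqvH s t : Prop := eqvL s t /\ eqvR s t.

Definition incomparableL s t : Prop := ~ leL s t /\ ~ leL t s.
Definition incomparableR s t : Prop := ~ leR s t /\ ~ leR t s.
Definition comparableL s t : Prop := ~ incomparableL s t.
Definition comparableR s t : Prop := ~ incomparableR s t.

Definition is_zero s : bool := `[< forall t, s * t = s /\ t * s = s >].
Definition nonzero s : bool := ~~ is_zero s.

Definition unambiguous : Prop :=
  forall s t u, nonzero s -> nonzero t -> nonzero u ->
    (ltL u s -> ltL u t -> comparableL s t) /\
    (ltR u s -> ltR u t -> comparableR s t).

(* r s and l s are the chosen representatives of the R-class, resp. the
   L-class, of s. *)
Record representatives (r l : S -> S) : Prop := Representatives {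
  rep_r_in : forall s, eqvR (r s) s;
  rep_r_class : forall s t, eqvR s t -> r s = r t;
  rep_l_in : forall s, eqvL (l s) s;
  rep_l_class : forall s t, eqvL s t -> l s = l t;
  rep_r_D : forall s t, eqvD (r s) (r t) -> eqvL (r s) (r t);
  rep_l_D : forall s t, eqvD (l s) (l t) -> eqvR (l s) (l t);
  rep_lr_H : forall s t, eqvH (l s) (r t) -> l s = r t
}.

(* Graphs of the partial functions B, B_R and B_L; the lemmas below show that
   each is single-valued and defined on the whole domain. *)
Definition B u v w (b : S) : Prop :=
  [/\ leL u v, leR w v &
      exists2 z, in_S1 z & w = rmul1 v z /\ b = rmul1 u z].

Definition BR (r : S -> S) u v (b : S) : Prop :=
  exists2 x, in_S1 x & v = lmul1 x u /\ b = lmul1 x (r u).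

Definition BL (l : S -> S) v u (b : S) : Prop :=
  exists2 y, in_S1 y & v = rmul1 u y /\ b = rmul1 (l u) y.

Lemma lrmul1A x t z : lmul1 x (rmul1 t z) = rmul1 (lmul1 x t) z.
Proof. by case: x z => [x|] [z|] //=; rewrite mulgA. Qed.

Lemma B_functional u v w : leL u v -> leR w v -> exists! b, B u v w b.
Proof.
move=> uv wv; have [z zS wE] := wv; have [x _ uE] := uv.
exists (rmul1 u z); split; first by split=> //; exists z.
by move=> _ [_ _ [z' _ [wE' ->]]]; rewrite uE -!lrmul1A -wE -wE'.
Qed.

Lemma BR_functional r l u v :
  representatives r l -> leL v u -> exists! b, BR r u v b.
Proof.
move=> rl [x xS vE]; have [[y _ rE] _] := rep_r_in rl u.
exists (lmul1 x (r u)); split; first by exists x.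
by move=> _ [x' _ [vE' ->]]; rewrite rE !lrmul1A -vE -vE'.
Qed.

Lemma BL_functional r l u v :
  representatives r l -> leR v u -> exists! b, BL l v u b.
Proof.
move=> rl [y yS vE]; have [[x _ lE] _] := rep_l_in rl u.
exists (rmul1 (l u) y); split; first by exists y.
by move=> _ [y' _ [vE' ->]]; rewrite lE -!lrmul1A -vE -vE'.
Qed.

End Green.

(* The alphabet: the symbol 0, the set S - {0} and its disjoint copy.  When S
   has a zero, that element is identified with the symbol 0 by inj. *)
Inductive letter (S : semigroupType) : Type :=
| Zero
| Pos of {s : S | nonzero s}
| Neg of {s : S | nonzero s}.
Arguments Zero {S}.

HB.instance Definition _ (S : semigroupType) := gen_eqMixin (letter S).
HB.instance Definition _ (S : semigroupType) := gen_choiceMixin (letter S).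

Section Presentation.
Variable S : semigroupType.

Definition inj (s : S) : letter S :=
  if insub s is Some p then Pos p else Zero.

Definition bar (a : letter S) : letter S :=
  match a with Zero => Zero | Pos p => Neg p | Neg p => Pos p end.

Implicit Types s t u v w b : S.
Notation word := (free_semigroup (letter S)).

Inductive reg_relation : word -> word -> Prop :=
| reg_mul s t :
    reg_relation [str inj s; inj t] [str inj (s * t)]
| reg_bar_mul s t : nonzero s -> nonzero t ->
    reg_relation [str bar (inj s); bar (inj t)] [str bar (inj (t * s))]
| reg_00 : reg_relation [str Zero] [str Zero; Zero]
| reg_0l s : reg_relation [str Zero] [str Zero; inj s]
| reg_0r s : reg_relation [str Zero] [str inj s; Zero]
| reg_0l_bar s : reg_relation [str Zero] [str Zero; bar (inj s)]
| reg_0r_bar s : reg_relation [str Zero] [str bar (inj s); Zero]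
| reg_incompL s t : nonzero s -> nonzero t -> incomparableL s t ->
    reg_relation [str inj s; bar (inj t)] [str Zero]
| reg_incompR s t : nonzero s -> nonzero t -> incomparableR s t ->
    reg_relation [str bar (inj s); inj t] [str Zero]
| reg_inv s : nonzero s ->
    reg_relation [str inj s; bar (inj s); inj s] [str inj s]
| reg_inv_bar s : nonzero s ->
    reg_relation [str bar (inj s); inj s; bar (inj s)] [str bar (inj s)].

Variables r l : S -> S.

Inductive rewrite_rule : word -> word -> Prop :=
| rule11 s t :
    rewrite_rule [str inj s; inj t] [str inj (s * t)]
| rule11_bar s t :
    rewrite_rule [str bar (inj s); bar (inj t)] [str bar (inj (t * s))]
| rule12_00 : rewrite_rule [str Zero; Zero] [str Zero]
| rule12_0l s : rewrite_rule [str Zero; inj s] [str Zero]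
| rule12_0r s : rewrite_rule [str inj s; Zero] [str Zero]
| rule12_0l_bar s : rewrite_rule [str Zero; bar (inj s)] [str Zero]
| rule12_0r_bar s : rewrite_rule [str bar (inj s); Zero] [str Zero]
| rule13 s t : nonzero s -> nonzero t -> incomparableL s t ->
    rewrite_rule [str inj s; bar (inj t)] [str Zero]
| rule14 s t : nonzero s -> nonzero t -> incomparableR s t ->
    rewrite_rule [str bar (inj s); inj t] [str Zero]
| rule15 u v w b : nonzero u -> nonzero v -> nonzero w ->
    leL u v -> leR w v -> B u v w b ->
    rewrite_rule [str inj u; bar (inj v); inj w] [str inj b]
| rule16 u v w b : nonzero u -> nonzero v -> nonzero w ->
    leR u v -> leL w v -> B w v u b ->
    rewrite_rule [str bar (inj u); inj v; bar (inj w)] [str bar (inj b)]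
| rule21 s t b : nonzero s -> nonzero t ->
    ltL t s -> s <> r s -> BR r s t b ->
    rewrite_rule [str inj s; bar (inj t)] [str inj (r s); bar (inj b)]
| rule22 s t b : nonzero s -> nonzero t ->
    ltR t s -> s <> l s -> BL l t s b ->
    rewrite_rule [str bar (inj s); inj t] [str bar (inj (l s)); inj b]
| rule23 s t b : nonzero s -> nonzero t ->
    leR t s -> s <> l s -> BL l t s b ->
    rewrite_rule [str bar (inj t); inj s] [str bar (inj b); inj (l s)]
| rule24 s t b : nonzero s -> nonzero t ->
    leL t s -> s <> r s -> BR r s t b ->
    rewrite_rule [str inj t; bar (inj s)] [str inj b; bar (inj (r s))].

End Presentation.

(* Main.v *)
Require Import Defs.
From HB Require Import structures.
From mathcomp Require Import all_boot.
From mathcomp Require Import boolp.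
From Corelib Require Import Setoid Morphisms.

(** Each of the two systems holds in the semigroup presented by the other.

    The defining relations are rewrite rules read in one or the other
    direction, except for the two inverse laws, which are [rule15] and
    [rule16] at u = v = w, where B(s, s, s) = s.

    Conversely, let ~ be the congruence generated by the defining relations,
    and write s' for the letter dual to s.  If u = xv and w = vz then
    u v' w ~ x v v' v z ~ xvz = B(u, v, w); this is [rule15], and [rule16] is
    dual since (st)' ~ t' s' (lemmas [congr_B], [congr_bar_B]).  These two
    facts alone yield the rules that introduce representatives.  If s and t
    are R-equivalent, then s s' t ~ t and s' t t' ~ s', so
    s s' ~ s s' t t' ~ t t': the idempotent s s' depends only on the R-class
    of s ([congr_eqvR]), and dually s' s depends only on its L-class
    ([congr_eqvL]).  For t below s in the L-order and r = r_s, inserting this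
    idempotent next to s or next to s' gives

      s t' ~ s s' s t' ~ r (r' s t') ~ r B(t, s, r)',
      t s' ~ t s' s s' ~ (t s' r) r' ~ B(t, s, r) r',

    and B(t, s, r) = B_R(s, t) because both are x r when t = x s ([BR_B]).
    These are [rule21] and [rule24]; exchanging L with R and letters with
    their duals turns them into [rule22] and [rule23]. *)

Local Open Scope group_scope.

#[local] Instance gen_congr_equivalence (T : semigroupType)
  (R : T -> T -> Prop) : Equivalence (gen_congr R).
Proof.
split; [exact: congr_refl | exact: congr_sym | exact: congr_trans].
Qed.

#[local] Instance gen_congr_mul_proper (T : semigroupType)
    (R : T -> T -> Prop) :
  Proper (gen_congr R ==> gen_congr R ==> gen_congr R) (@mul T).
Proof. by move=> x x' xx' y y' yy'; exact: congr_mul. Qed.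

#[local] Hint Resolve congr_refl : core.

Lemma gen_congr_sub (T : semigroupType) (R R' : T -> T -> Prop) :
  (forall x y, R x y -> gen_congr R' x y) ->
  forall x y, gen_congr R x y -> gen_congr R' x y.
Proof.
move=> RR' x y.
elim=> {x y} [x y /RR' //|x|x y _|x y z _ xy _|x x' y y' _ xx' _].
- exact: congr_refl.
- exact: congr_sym.
- exact: congr_trans.
- exact: congr_mul.
Qed.

Lemma str2E (A : choiceType) (a b : A) : [str a; b] = [str a] * [str b].
Proof. exact: val_inj. Qed.

Lemma str3E (A : choiceType) (a b c : A) :
  [str a; b; c] = [str a] * [str b] * [str c].
Proof. exact: val_inj. Qed.

Section GreenFacts.
Variable S : semigroupType.
Implicit Types s t u v w b : S.

(** The identity of S^1 lies in S or is adjoined, according to whether S is a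
    monoid; this makes the witness for reflexivity depend on the case. *)
Lemma S1_identity : exists2 z : option S, in_S1 z &
  forall s, lmul1 z s = s /\ rmul1 s z = s.
Proof.
case: (pselect (is_monoid S)) => [[e eE]|noE]; last by exists None.
by exists (Some e) => // s; apply: eE.
Qed.

Lemma leL_refl s : leL s s.
Proof. by have [z zS1 zE] := S1_identity; exists z => //; rewrite (zE s).1. Qed.

Lemma leR_refl s : leR s s.
Proof. by have [z zS1 zE] := S1_identity; exists z => //; rewrite (zE s).2. Qed.

Lemma B_right s w : leR w s -> B s s w w.
Proof.
move=> ws; have [z zS1 wE] := ws.
by split=> //; [exact: leL_refl | exists z].
Qed.

Lemma B_left u s : leL u s -> B u s s u.
Proof.
move=> us; split=> //; first exact: leR_refl.
by have [z zS1 zE] := S1_identity; exists z => //; rewrite !(zE _).2.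
Qed.

Lemma BR_B (r : S -> S) s t b :
  leR (r s) s -> leL t s -> BR r s t b -> B t s (r s) b.
Proof.
move=> rs ts [x _ [tE ->]]; split=> //; have [z zS1 rE] := rs.
by exists z => //; rewrite rE tE lrmul1A.
Qed.

Lemma BL_B (l : S -> S) s t b :
  leL (l s) s -> leR t s -> BL l t s b -> B (l s) s t b.
Proof. by move=> ls ts [y yS1 [tE ->]]; split=> //; exists y. Qed.

Lemma inj_zero s : is_zero s -> inj s = Zero.
Proof. by move=> s0; rewrite /inj insubF // /nonzero s0. Qed.

Notation word := (free_semigroup (letter S)).
Local Notation "x =~ y" := (gen_congr (@reg_relation S) x y)
  (at level 70, no associativity).
Local Notation P s := ([str inj s] : word).
Local Notation N s := ([str bar (inj s)] : word).

Lemma congr_mulP s t : P (s * t) =~ P s * P t.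
Proof. by rewrite -str2E; symmetry; apply/congr_base/reg_mul. Qed.

Lemma congr_00 : [str Zero] * [str Zero] =~ [str Zero].
Proof. by rewrite -str2E; symmetry; apply/congr_base/reg_00. Qed.

(** The defining relation covers nonzero s and t only, but the convention that
    0 is its own dual extends it to all of S. *)
Lemma congr_mulN s t : N (t * s) =~ N s * N t.
Proof.
rewrite -str2E; symmetry.
have [s0|sN0] := boolP (is_zero s).
  have /asboolP/(_ t)[_ tsE] := s0.
  by rewrite tsE (inj_zero s) //; symmetry; apply/congr_base/reg_0l_bar.
have [t0|tN0] := boolP (is_zero t).
  have /asboolP/(_ s)[tsE _] := t0.
  by rewrite tsE (inj_zero t) //; symmetry; apply/congr_base/reg_0r_bar.
exact/congr_base/reg_bar_mul.
Qed.

Lemma congr_PNP s : P s * N s * P s =~ P s.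
Proof.
have [s0|sN0] := boolP (is_zero s); first by rewrite inj_zero //= !congr_00.
by rewrite -str3E; apply/congr_base/reg_inv.
Qed.

Lemma congr_NPN s : N s * P s * N s =~ N s.
Proof.
have [s0|sN0] := boolP (is_zero s); first by rewrite inj_zero //= !congr_00.
by rewrite -str3E; apply/congr_base/reg_inv_bar.
Qed.

Lemma congr_B u v w b : B u v w b -> P u * N v * P w =~ P b.
Proof.
case=> -[x _ ->] _ [z _ [-> ->]].
have PNPz : P v * N v * P (rmul1 v z) =~ P (rmul1 v z).
  case: z => [z|] /=; last exact: congr_PNP.
  by rewrite congr_mulP mulgA congr_PNP.
rewrite -lrmul1A; case: x => [x|] //=.
by rewrite !congr_mulP -!mulgA (mulgA (P v)) PNPz.
Qed.

Lemma congr_bar_B u v w b : B w v u b -> N u * P v * N w =~ N b.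
Proof.
case=> -[x _ ->] _ [z _ [-> ->]].
have NPNx : N v * P v * N (lmul1 x v) =~ N (lmul1 x v).
  case: x => [x|] /=; last exact: congr_NPN.
  by rewrite congr_mulN mulgA congr_NPN.
case: z => [z|] //=.
by rewrite !congr_mulN -!mulgA (mulgA (N v)) NPNx.
Qed.

(** The product p p' q q' collapses to q q' from the left and to p p' from the
    right. *)
Lemma congr_absorb (p p' q q' : word) :
  p * p' * q =~ q -> p' * q * q' =~ p' -> p * p' =~ q * q'.
Proof.
by move=> pq qp; rewrite -{1}qp -!mulgA (mulgA p) (mulgA (p * p')) pq.
Qed.

Lemma congr_eqvR s t : eqvR s t -> P s * N s =~ P t * N t.
Proof.
move=> [st ts]; apply: congr_absorb.
- exact/congr_B/B_right.
- exact/congr_bar_B/B_right.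
Qed.

Lemma congr_eqvL s t : eqvL s t -> N s * P s =~ N t * P t.
Proof.
move=> [st ts]; apply: congr_absorb.
- exact/congr_bar_B/B_left.
- exact/congr_B/B_left.
Qed.

Lemma relation_of_rules (r l : S -> S) (x y : word) :
  reg_relation x y -> gen_congr (rewrite_rule r l) x y.
Proof.
case=> [s t|s t _ _||s|s|s|s|s t sN0 tN0 st|s t sN0 tN0 st|s sN0|s sN0].
- exact/congr_base/rule11.
- exact/congr_base/rule11_bar.
- exact/congr_sym/congr_base/rule12_00.
- exact/congr_sym/congr_base/rule12_0l.
- exact/congr_sym/congr_base/rule12_0r.
- exact/congr_sym/congr_base/rule12_0l_bar.
- exact/congr_sym/congr_base/rule12_0r_bar.
- exact/congr_base/rule13.
- exact/congr_base/rule14.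
- apply/congr_base/rule15 => //; [exact: leL_refl | exact: leR_refl |].
  exact/B_left/leL_refl.
- apply/congr_base/rule16 => //; [exact: leR_refl | exact: leL_refl |].
  exact/B_left/leL_refl.
Qed.

Lemma rule_of_relations (r l : S -> S) (x y : word) :
  (forall s, eqvR (r s) s) -> (forall s, eqvL (l s) s) ->
  rewrite_rule r l x y -> x =~ y.
Proof.
move=> rR lL.
case=> [s t|s t||s|s|s|s|s t sN0 tN0 st|s t sN0 tN0 st
       |u v w b _ _ _ _ _ uvw|u v w b _ _ _ _ _ wvu
       |s t b _ _ [ts _] _ tb|s t b _ _ [ts _] _ tb
       |s t b _ _ ts _ tb|s t b _ _ ts _ tb].
- exact/congr_base/reg_mul.
- by rewrite str2E; symmetry; apply: congr_mulN.
- exact/congr_sym/congr_base/reg_00.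
- exact/congr_sym/congr_base/reg_0l.
- exact/congr_sym/congr_base/reg_0r.
- exact/congr_sym/congr_base/reg_0l_bar.
- exact/congr_sym/congr_base/reg_0r_bar.
- exact/congr_base/reg_incompL.
- exact/congr_base/reg_incompR.
- by rewrite str3E; apply: congr_B.
- by rewrite str3E; apply: congr_bar_B.
- have bE := BR_B r s t b (rR s).1 ts tb; rewrite !str2E.
  by rewrite -(congr_PNP s) -(congr_eqvR _ _ (rR s)) -2!mulgA (mulgA (N (r s)))
             (congr_bar_B _ _ _ _ bE).
- have bE := BL_B l s t b (lL s).1 ts tb; rewrite !str2E.
  by rewrite -(congr_NPN s) -(congr_eqvL _ _ (lL s)) -2!mulgA (mulgA (P (l s)))
             (congr_B _ _ _ _ bE).
- have bE := BL_B l s t b (lL s).1 ts tb; rewrite !str2E.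
  by rewrite -(congr_PNP s) -(mulgA (P s)) -(congr_eqvL _ _ (lL s)) !mulgA
             (congr_bar_B _ _ _ _ bE).
- have bE := BR_B r s t b (rR s).1 ts tb; rewrite !str2E.
  by rewrite -(congr_NPN s) -(mulgA (N s)) -(congr_eqvR _ _ (rR s)) !mulgA
             (congr_B _ _ _ _ bE).
Qed.

End GreenFacts.

Theorem proposition2p1 (S : semigroupType) (r l : S -> S)
    (hS : unambiguous S) (hrl : representatives r l)
    (x y : free_semigroup (letter S)) :
  gen_congr (rewrite_rule r l) x y <-> gen_congr (@reg_relation S) x y.
Proof.
split; apply: gen_congr_sub => {}x {}y.
- by apply: rule_of_relations; [exact: rep_r_in hrl | exact: rep_l_in hrl].
- exact: relation_of_rules.
Qed.
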